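(* Let $J_+=\{j:\lambda_j>0\}$, $x_j^\star=\langle X^\star,\omega_j\rangle$ and $$\delta_-=\sqrt{\frac2\pi}\sqrt{\frac{\sum_{j\in J_+}(x_j^\star)^2}{\sum_{j\in J_+}\frac{(x_j^\star)^2}{\lambda_j}}},\qquad \delta_+=\sqrt{\frac\pi2}\sqrt{\frac{\sum_{j\in J_+}\lambda_j^2(x_j^\star)^2}{\sum_{j\in J_+}\lambda_j(x_j^\star)^2}}.$$ Suppose that for the learning rates $\gamma>0$ under consideration ($\gamma\to0$, with $K,X_0,X^\star,\delta,d$ fixed) the following hold: $\mathsf R(0),\widehat{\mathsf B}_{44}(0)>0$, $(X^\star)^\top KX^\star>0$, $\sup_{t\ge0}\mathsf R^{\mathrm{Adv}}(t)<\infty$, $\delta>0$, $q(t)$ converges in $(0,\infty)$ as $t\to\infty$, and $\delta\le\sqrt{\lambda_{\min}^+/r_\star}$. For $\gamma>0$ let $q_\gamma(\infty)\in(0,\infty)$ be an admissible solution of the fixed point equation in the context. Then as $\gamma\to0$: - if $\delta\le\delta_-$ then $q_\gamma(\infty)\to\infty$ and $\tilde\lambda^{\mathrm{eff}}(q_\gamma(\infty))\to\tilde\lambda_\star=0$; - if $\delta_-<\delta<\delta_+$ then $q_\gamma(\infty)\to q_\star\in(0,\infty)$ and $\tilde\lambda^{\mathrm{eff}}(q_\gamma(\infty))\to\tilde\lambda_\star\in(0,\infty)$; - if $\delta\ge\delta_+$ then $q_\gamma(\infty)\to0$ and $\tilde\lambda^{\mathrm{eff}}(q_\gamma(\infty))\to\tilde\lambda_\star=\infty$.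 If $\delta_-<\delta<\delta_+$, then $(q_\star,\tilde\lambda_\star)$ is the unique solution of $$q_\star=\sqrt{\frac{\sum_{j\in J_+}\frac{\lambda_j^2}{(\lambda_j+\tilde\lambda_\star)^2}(x_j^\star)^2}{\sum_{j\in J_+}\lambda_j\frac{\tilde\lambda_\star^2}{(\lambda_j+\tilde\lambda_\star)^2}(x_j^\star)^2}},\qquad\tilde\lambda_\star=\frac{\delta^2+\delta\sqrt{\frac2\pi}\frac1{q_\star}}{1+\delta\sqrt{\frac2\pi}q_\star}.$$ If $K=I_d$ then $\delta_-=\sqrt{2/\pi}$, $\delta_+=\sqrt{\pi/2}$, and for $\delta_-<\delta<\delta_+$ $$q_\star=\frac{1-\delta\sqrt{2/\pi}}{\delta(\delta-\sqrt{2/\pi})},\qquad\tilde\lambda_\star=\frac{\delta^2-\delta\sqrt{2/\pi}}{1-\delta\sqrt{2/\pi}}.$$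
   Context: Setting: noiseless $\ell_2$-adversarial least squares on a single class $a\sim\mathcal N(0,K)$, $K\in\mathbb R^{d\times d}$ symmetric positive semidefinite with orthonormal eigenpairs $(\lambda_j,\omega_j)_{1\le j\le d}$, $\lambda^+_{\min}$ the smallest nonzero eigenvalue; $X^\star,X_0\in\mathbb R^d$; adversarial radius $\delta>0$; constant learning rate $\gamma>0$. *Dynamics.* $\mathsf V_{j,22}\equiv(x_j^\star)^2$, $\mathsf V_{j,11}(0)=\langle X_0,\omega_j\rangle^2$, $\mathsf V_{j,12}(0)=\langle X_0,\omega_j\rangle x_j^\star$, $$\dot{\mathsf V}_{j,11}=-2\tilde\gamma^{\mathrm{eff}}(\lambda_j+\tilde\lambda^{\mathrm{eff}})\mathsf V_{j,11}+2\tilde\gamma^{\mathrm{eff}}\lambda_j\mathsf V_{j,12}+2\lambda_j\frac{\gamma^2}d\mathsf R^{\mathrm{Adv}},\qquad \dot{\mathsf V}_{j,12}=-\tilde\gamma^{\mathrm{eff}}(\lambda_j+\tilde\lambda^{\mathrm{eff}})\mathsf V_{j,12}+\tilde\gamma^{\mathrm{eff}}\lambda_j\mathsf V_{j,22},$$ $\mathsf R=\tfrac12\sum_j\lambda_j(\mathsf V_{j,11}-2\mathsf V_{j,12}+\mathsf V_{j,22})$, $\widehat{\mathsf B}_{44}=\sum_j\mathsf V_{j,11}$, $\mathsf R^{\mathrm{Adv}}=\mathsf R+\delta\sqrt{2/\pi}\sqrt{2\widehat{\mathsf B}_{44}\mathsf R}+\tfrac{\delta^2}2\widehat{\mathsf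 B}_{44}$, $q(t)=\sqrt{\widehat{\mathsf B}_{44}/(2\mathsf R)}$, $\tilde\gamma^{\mathrm{eff}}=\gamma(1+\delta\sqrt{2/\pi}\,q)$, $\tilde\lambda^{\mathrm{eff}}=\tilde\lambda^{\mathrm{eff}}(q(t))$ with $\tilde\lambda^{\mathrm{eff}}(q)=\frac{\delta^2+\delta\sqrt{2/\pi}\,q^{-1}}{1+\delta\sqrt{2/\pi}\,q}$. *Fixed point equation.* $$q^2=\big(1-G(q)C_{\mathsf R}(q)\big)\frac{L_\infty(q)}{2F_\infty(q)}+\frac12G(q)C_{\mathsf B}(q);$$ a solution is admissible if $G(q)C_{\mathsf R}(q)<1$. Here $G(q)=1+2\delta\sqrt{2/\pi}q+\delta^2q^2$, $D_j(q)=\lambda_j(1+\delta\sqrt{2/\pi}q)+\delta^2+\delta\sqrt{2/\pi}\,q^{-1}$, $C_{\mathsf R}(q)=\frac\gamma{2d}\sum_j\frac{\lambda_j^2}{D_j(q)}$, $C_{\mathsf B}(q)=\frac\gamma d\sum_j\frac{\lambda_j}{D_j(q)}$, $F_\infty(q)=\frac12\sum_j\lambda_j\big(\frac{\tilde\lambda^{\mathrm{eff}}(q)}{\lambda_j+\tilde\lambda^{\mathrm{eff}}(q)}\big)^2(x_j^\star)^2$, $L_\infty(q)=\sum_j\big(\frac{\lambda_j}{\lambda_j+\tilde\lambda^{\mathrm{eff}}(q)}\big)^2(x_j^\star)^2$. *Constant.* $r_\star=\sup_{s>0}\max(P(s)/Q(s),0)\approx8.35\times10^{-5}$ with $c=\sqrt{2/\pi}$,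 $P(s)=(2-3c^2)s^4+(3c-7c^3)s^3-(4c^4+2c^2)s^2-(3c^3+c)s-c^2$, $Q(s)=c^2s^6+(7c^3-c)s^5+(8c^4+8c^2-2)s^4+(15c^3+c)s^3+9c^2s^2+2cs$. *)

(* Defs.v *)
From HB Require Import structures.
From mathcomp Require Export all_boot all_order all_algebra.
From mathcomp Require Export all_classical all_reals all_analysis.

Set Implicit Arguments.
Unset Strict Implicit.
Unset Printing Implicit Defensive.

Import Order.TTheory GRing.Theory Num.Theory.
Import numFieldNormedType.Exports.
Local Open Scope classical_set_scope.
Local Open Scope ring_scope.

Definition cpi {R : realType} : R := Num.sqrt (2 / pi).

Definition dotp (R : realType) (d : nat) (u v : 'cV[R]_d) : R :=
  (u^T *m v) 0 0.

Definition psd (R : realType) (d : nat) (K : 'M[R]_d) : Prop :=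
  K^T = K /\ forall v : 'cV[R]_d, 0 <= dotp v (K *m v).

Definition orthonormal_eigenpairs (R : realType) (d : nat) (K : 'M[R]_d)
    (lam : 'I_d -> R) (omega : 'I_d -> 'cV[R]_d) : Prop :=
  (forall j, K *m omega j = lam j *: omega j) /\
  (forall i j, dotp (omega i) (omega j) = (i == j)%:R).

(* The infimum is over a finite set, nonempty as soon as K != 0; it is then
   attained. *)
Definition lam_min_pos (R : realType) (d : nat) (K : 'M[R]_d) : R :=
  inf [set a | eigenvalue K a /\ a != 0].

(* v11 j and v12 j below stand for V_{j,11} and V_{j,12} at a given time, and
   x j for the coordinate <X^*, omega_j>, so that V_{j,22} = x j ^+ 2. *)

Definition risk (R : realType) (d : nat) (lam x v11 v12 : 'I_d -> R) : R :=
  2^-1 * \sum_j lam j * (v11 j - 2 * v12 j + x j ^+ 2).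

Definition B44 (R : realType) (d : nat) (v11 : 'I_d -> R) : R :=
  \sum_j v11 j.

Definition risk_adv (R : realType) (d : nat) (delta : R)
    (lam x v11 v12 : 'I_d -> R) : R :=
  risk lam x v11 v12
  + delta * cpi * Num.sqrt (2 * B44 v11 * risk lam x v11 v12)
  + delta ^+ 2 / 2 * B44 v11.

Definition qratio (R : realType) (d : nat) (lam x v11 v12 : 'I_d -> R) : R :=
  Num.sqrt (B44 v11 / (2 * risk lam x v11 v12)).

Definition gam_eff (R : realType) (gam delta q : R) : R :=
  gam * (1 + delta * cpi * q).

Definition lam_eff (R : realType) (delta q : R) : R :=
  (delta ^+ 2 + delta * cpi * q^-1) / (1 + delta * cpi * q).

Definition field11 (R : realType) (d : nat) (gam delta : R)
    (lam x v11 v12 : 'I_d -> R) (j : 'I_d) : R :=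
  let q := qratio lam x v11 v12 in
  - (2 * gam_eff gam delta q * (lam j + lam_eff delta q) * v11 j)
  + 2 * gam_eff gam delta q * lam j * v12 j
  + 2 * lam j * (gam ^+ 2 / d%:R) * risk_adv delta lam x v11 v12.

Definition field12 (R : realType) (d : nat) (gam delta : R)
    (lam x v11 v12 : 'I_d -> R) (j : 'I_d) : R :=
  let q := qratio lam x v11 v12 in
  - (gam_eff gam delta q * (lam j + lam_eff delta q) * v12 j)
  + gam_eff gam delta q * lam j * x j ^+ 2.

(* V11 t j, V12 t j solve the initial value problem on [0, +oo[; x0 j is
   <X_0, omega_j>. The functions are continuous on [0, +oo[ and the equations
   hold at every t > 0, which leaves the values at t < 0 irrelevant. Positivity
   of R(t) and B44(t) is not imposed for t > 0: where one of them vanishes,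
   q and 1/q take the value given by the convention 0^-1 = 0, so that every
   solution along which the field is well defined is covered. *)
Definition adv_flow (R : realType) (d : nat) (gam delta : R)
    (lam x x0 : 'I_d -> R) (V11 V12 : R -> 'I_d -> R) : Prop :=
  forall j : 'I_d,
  [/\ V11 0 j = x0 j ^+ 2,
      V12 0 j = x0 j * x j,
      {within `[0, +oo[, continuous (fun t => V11 t j)},
      {within `[0, +oo[, continuous (fun t => V12 t j)} &
      forall t : R, 0 < t ->
        is_derive t 1 (fun s => V11 s j)
          (field11 gam delta lam x (V11 t) (V12 t) j) /\
        is_derive t 1 (fun s => V12 s j)
          (field12 gam delta lam x (V11 t) (V12 t) j)].

Definition Gfp (R : realType) (delta q : R) : R :=
  1 + 2 * delta * cpi * q + delta ^+ 2 * q ^+ 2.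

Definition Dfp (R : realType) (delta l q : R) : R :=
  l * (1 + delta * cpi * q) + delta ^+ 2 + delta * cpi * q^-1.

Definition CR (R : realType) (d : nat) (gam delta : R) (lam : 'I_d -> R)
    (q : R) : R :=
  gam / (2 * d%:R) * \sum_j lam j ^+ 2 / Dfp delta (lam j) q.

Definition CB (R : realType) (d : nat) (gam delta : R) (lam : 'I_d -> R)
    (q : R) : R :=
  gam / d%:R * \sum_j lam j / Dfp delta (lam j) q.

Definition Finfty (R : realType) (d : nat) (delta : R) (lam x : 'I_d -> R)
    (q : R) : R :=
  2^-1 * \sum_j lam j
    * (lam_eff delta q / (lam j + lam_eff delta q)) ^+ 2 * x j ^+ 2.

Definition Linfty (R : realType) (d : nat) (delta : R) (lam x : 'I_d -> R)
    (q : R) : R :=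
  \sum_j (lam j / (lam j + lam_eff delta q)) ^+ 2 * x j ^+ 2.

Definition fixed_point (R : realType) (d : nat) (gam delta : R)
    (lam x : 'I_d -> R) (q : R) : Prop :=
  q ^+ 2 =
    (1 - Gfp delta q * CR gam delta lam q)
      * (Linfty delta lam x q / (2 * Finfty delta lam x q))
    + 2^-1 * Gfp delta q * CB gam delta lam q.

Definition admissible_solution (R : realType) (d : nat) (gam delta : R)
    (lam x : 'I_d -> R) (q : R) : Prop :=
  [/\ 0 < q, fixed_point gam delta lam x q &
      Gfp delta q * CR gam delta lam q < 1].

Definition Prs (R : realType) (s : R) : R :=
  let c := cpi : R in
  (2 - 3 * c ^+ 2) * s ^+ 4 + (3 * c - 7 * c ^+ 3) * s ^+ 3
  - (4 * c ^+ 4 + 2 * c ^+ 2) * s ^+ 2 - (3 * c ^+ 3 + c) * s - c ^+ 2.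

Definition Qrs (R : realType) (s : R) : R :=
  let c := cpi : R in
  c ^+ 2 * s ^+ 6 + (7 * c ^+ 3 - c) * s ^+ 5
  + (8 * c ^+ 4 + 8 * c ^+ 2 - 2) * s ^+ 4 + (15 * c ^+ 3 + c) * s ^+ 3
  + 9 * c ^+ 2 * s ^+ 2 + 2 * c * s.

(* The set is bounded above, with supremum approximately 8.35e-5. *)
Definition r_star {R : realType} : R :=
  sup [set Num.max (Prs s / Qrs s) 0 | s in [set s : R | 0 < s]].

Definition delta_minus (R : realType) (d : nat) (lam x : 'I_d -> R) : R :=
  Num.sqrt (2 / pi) *
  Num.sqrt ((\sum_(j | 0 < lam j) x j ^+ 2)
            / (\sum_(j | 0 < lam j) x j ^+ 2 / lam j)).

Definition delta_plus (R : realType) (d : nat) (lam x : 'I_d -> R) : R :=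
  Num.sqrt (pi / 2) *
  Num.sqrt ((\sum_(j | 0 < lam j) lam j ^+ 2 * x j ^+ 2)
            / (\sum_(j | 0 < lam j) lam j * x j ^+ 2)).

Definition limit_system (R : realType) (d : nat) (delta : R)
    (lam x : 'I_d -> R) (q l : R) : Prop :=
  q = Num.sqrt
        ((\sum_(j | 0 < lam j) lam j ^+ 2 / (lam j + l) ^+ 2 * x j ^+ 2)
         / (\sum_(j | 0 < lam j)
              lam j * (l ^+ 2 / (lam j + l) ^+ 2) * x j ^+ 2)) /\
  l = (delta ^+ 2 + delta * Num.sqrt (2 / pi) * q^-1)
      / (1 + delta * Num.sqrt (2 / pi) * q).

(* Main.v *)
(* Let c = sqrt (2 / pi) < 1, l(q) = lam_eff q and t(q) = q * l(q), which
   increases strictly from delta * c to delta / c. With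
   rho(l) = (sum lam_j^2 x_j^2 / (lam_j + l)^2)
            / (sum lam_j x_j^2 / (lam_j + l)^2),
   the fixed point equation at learning rate 0 reads H(q) = 1 for
   H = t^2 / rho(l). Chebyshev's sum inequality makes rho nondecreasing in l, so
   H is strictly increasing, and delta_-, delta_+ are the values of delta at
   which its supremum, respectively its infimum, equals 1. For gam > 0 the
   equation becomes H (1 - e) = 1 - g with 0 <= g <= gam * A(M) for q <= M and
   0 <= e <= gam * B(eps) for q >= eps. Hence H(M) < 1 forces q > M for small
   gam, and H(eps) > 1 forces q < eps; the three limits follow. *)

Require Import Defs.
From mathcomp Require Import ring lra.

Set Implicit Arguments.
Unset Strict Implicit.
Unset Printing Implicit Defensive.

Import Order.TTheory GRing.Theory Num.Theory.
Import numFieldNormedType.Exports.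
Local Open Scope classical_set_scope.
Local Open Scope ring_scope.

(** * The constant c and Chebyshev's sum inequality *)

Lemma cpi_gt0 (R : realType) : 0 < (cpi : R).
Proof. by rewrite sqrtr_gt0 divr_gt0 ?pi_gt0. Qed.

(** If pi / 2 were 1, then cos 1 would vanish, whereas it is positive; so pi / 2 > 1 strictly. *)
Lemma cpi_lt1 (R : realType) : (cpi : R) < 1.
Proof.
have pihalf_gt1 : 1 < pi / 2 :> R.
  rewrite lt_neqAle pihalf_ge1 andbT; apply/eqP => e.
  by have := cos1_gt0 R; rewrite e cos_pihalf ltxx.
rewrite -sqrtr1 ltr_sqrt// -invf_div invf_lt1 //.
by rewrite divr_gt0 ?pi_gt0.
Qed.

(** The difference [T] of the two sides is a double sum over (i, j). Adding to it the copy with i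
    and j exchanged gives 2 [T], whose summands are the quantities assumed nonnegative. *)
Lemma chebyshev_sum (R : realFieldType) (I : finType) (P : pred I)
    (u f g : I -> R) :
  (forall i j, P i -> P j -> 0 <= (u i - u j) * (f i * g j - f j * g i)) ->
  (\sum_(i | P i) u i * g i) * (\sum_(i | P i) f i)
    <= (\sum_(i | P i) u i * f i) * (\sum_(i | P i) g i).
Proof.
move=> ufg; rewrite !big_distrlr/= -subr_ge0.
set T := _ - _.
have TE : T = \sum_(i | P i) \sum_(j | P j) u i * (f i * g j - f j * g i).
  rewrite /T -sumrB; apply: eq_bigr => i _; rewrite -sumrB.
  by apply: eq_bigr => j _; ring.
have : 0 <= T + T.
  rewrite {2}TE exchange_big/= TE -big_split/= sumr_ge0// => i Pi.
  rewrite -big_split/= sumr_ge0// => j Pj.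
  by have := ufg i j Pi Pj; lra.
by lra.
Qed.

(** * Weighted spectral sums and monotonicity of their ratio *)

Section WeightedSums.
Variables (R : realFieldType) (d : nat) (lam x : 'I_d -> R).

(* The ratio [b / a] plays the role of the effective regularisation; the
   homogeneous form makes the endpoints [0] and [+oo] of its range, that is
   [(a, b) = (1, 0)] and [(0, 1)], regular. *)
Definition wsum (k : nat) (a b : R) : R :=
  \sum_(j | 0 < lam j) lam j ^+ k * x j ^+ 2 / (lam j * a + b) ^+ 2.

Lemma affine_gt0 (l a b : R) : 0 < l -> 0 <= a -> 0 <= b -> 0 < a + b ->
  0 < l * a + b.
Proof.
move=> l0; rewrite le_eqVlt => /predU1P[<-|a0 b0 _].
  by rewrite mulr0 !add0r.
by rewrite ltr_pwDl// mulr_gt0.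
Qed.

Lemma wsum_gt0 k a b (j : 'I_d) : 0 < lam j -> x j != 0 ->
  0 <= a -> 0 <= b -> 0 < a + b -> 0 < wsum k a b.
Proof.
move=> lj xj a0 b0 ab; rewrite /wsum (bigD1 j)//= ltr_pwDl//.
  apply: divr_gt0; last by rewrite exprn_gt0 ?affine_gt0.
  by apply: mulr_gt0; [exact: exprn_gt0 | rewrite exprn_even_gt0].
apply: sumr_ge0 => i /andP[li _].
  by rewrite divr_ge0 ?sqr_ge0// mulr_ge0 ?sqr_ge0// exprn_ge0// ltW.
Qed.

Lemma wsum_scale k s a b :
  wsum k (s * a) (s * b) = wsum k a b / s ^+ 2.
Proof.
rewrite /wsum mulr_suml; apply: eq_bigr => j _.
rewrite (_ : lam j * (s * a) + s * b = s * (lam j * a + b)); last by ring.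
by rewrite exprMn invfM mulrCA mulrC.
Qed.

(** The ratio rho of the sums of orders 2 and 1 is nondecreasing in b / a. This is Chebyshev with
    [u := lam]: the quotient of the weights at (a2, b2) and (a1, b1) is the square of (lam a1 + b1)
    / (lam a2 + b2), which is nondecreasing in lam because a1 b2 - a2 b1 >= 0. *)
Lemma wsum_mono a1 b1 a2 b2 :
  0 <= a1 -> 0 <= b1 -> 0 < a1 + b1 -> 0 <= a2 -> 0 <= b2 -> 0 < a2 + b2 ->
  a2 * b1 <= a1 * b2 ->
  wsum 2 a1 b1 * wsum 1 a2 b2 <= wsum 2 a2 b2 * wsum 1 a1 b1.
Proof.
move=> a10 b10 s1 a20 b20 s2 le12.
pose f a b j := lam j ^+ 1 * x j ^+ 2 / (lam j * a + b) ^+ 2.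
have wsum2E a b : wsum 2 a b = \sum_(j | 0 < lam j) lam j * f a b j.
  by apply: eq_bigr => j _; rewrite /f !mulrA exprS.
rewrite !wsum2E; apply: chebyshev_sum => i j li lj.
have Di1 := affine_gt0 li a10 b10 s1; have Di2 := affine_gt0 li a20 b20 s2.
have Dj1 := affine_gt0 lj a10 b10 s1; have Dj2 := affine_gt0 lj a20 b20 s2.
set Ei1 := lam i * a1 + b1 in Di1; set Ei2 := lam i * a2 + b2 in Di2.
set Ej1 := lam j * a1 + b1 in Dj1; set Ej2 := lam j * a2 + b2 in Dj2.
(* The numerator contains a difference of two squares, whose factor Ej2 Ei1 - Ei2 Ej1 equals (lam i
   - lam j) (a1 b2 - a2 b1); this yields the square (lam i - lam j)^2. *)
have -> : (lam i - lam j) * (f a2 b2 i * f a1 b1 j - f a2 b2 j * f a1 b1 i) =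
    lam i * lam j * (x i * x j) ^+ 2 * (lam i - lam j) ^+ 2
    * (a1 * b2 - a2 * b1) * (Ej2 * Ei1 + Ei2 * Ej1)
    / (Ei1 * Ei2 * Ej1 * Ej2) ^+ 2.
  rewrite /f -/Ei1 -/Ei2 -/Ej1 -/Ej2.
  rewrite (_ : lam i * lam j * (x i * x j) ^+ 2 * (lam i - lam j) ^+ 2
    * (a1 * b2 - a2 * b1) = lam i * lam j * (x i * x j) ^+ 2
     * ((lam i - lam j) ^+ 2 * (a1 * b2 - a2 * b1))); last by ring.
  rewrite (_ : (lam i - lam j) ^+ 2 * (a1 * b2 - a2 * b1)
      = (lam i - lam j) * (Ej2 * Ei1 - Ei2 * Ej1)); last first.
    by rewrite /Ei1 /Ei2 /Ej1 /Ej2; ring.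
  clearbody Ei1 Ei2 Ej1 Ej2.
  by field; rewrite !gt_eqF.
rewrite divr_ge0 ?sqr_ge0// mulr_ge0//; last first.
  by rewrite addr_ge0// mulr_ge0// ltW.
rewrite mulr_ge0 ?subr_ge0// mulr_ge0 ?sqr_ge0// mulr_ge0 ?sqr_ge0//.
by rewrite mulr_ge0// ltW.
Qed.

End WeightedSums.

(** * The function H: monotonicity, range and root *)

Section FixedPoint.
Variables (R : realType) (d : nat) (lam x : 'I_d -> R) (delta : R).
Variable j0 : 'I_d.
Hypotheses (lam_ge0 : forall j, 0 <= lam j).
Hypotheses (lam_j0 : 0 < lam j0) (x_j0 : x j0 != 0) (delta_gt0 : 0 < delta).

Local Notation c := (cpi : R).

Let c_gt0 : 0 < c. Proof. exact: cpi_gt0. Qed.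
Let c_lt1 : c < 1. Proof. exact: cpi_lt1. Qed.
Let c2_lt1 : c ^+ 2 < 1. Proof. by rewrite expr_lt1 ?ltW. Qed.
Let dc_gt0 : 0 < delta * c. Proof. exact: mulr_gt0. Qed.
Let d2_gt0 : 0 < delta ^+ 2. Proof. exact: exprn_gt0. Qed.

(** Clearing [q^-1] gives lam_eff = mfp / (q nfp), a quotient of polynomials; mfp / nfp is t(q) = q
    lam_eff(q). *)
Definition nfp (q : R) : R := 1 + delta * c * q.
Definition mfp (q : R) : R := delta ^+ 2 * q + delta * c.

Local Notation S1 q := (wsum lam x 1 (q * nfp q) (mfp q)).
Local Notation S2 q := (wsum lam x 2 (q * nfp q) (mfp q)).

(* [Hfp q = q ^+ 2 * 2 * Finfty q / Linfty q], so that [Hfp q = 1] is the fixed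
   point equation at learning rate [0]. *)
Definition Hfp (q : R) : R := mfp q ^+ 2 * S1 q / (nfp q ^+ 2 * S2 q).

Lemma nfp_gt0 q : 0 <= q -> 0 < nfp q.
Proof. by move=> q0; rewrite /nfp ltr_pwDl// mulr_ge0// ltW. Qed.

Lemma mfp_gt0 q : 0 <= q -> 0 < mfp q.
Proof. by move=> q0; rewrite /mfp ltr_wpDl// mulr_ge0// ltW. Qed.

Lemma lam_effE q : 0 < q -> lam_eff delta q = mfp q / (q * nfp q).
Proof.
move=> q0; rewrite /lam_eff -/(nfp q) /mfp.
by field; rewrite !gt_eqF ?nfp_gt0 ?ltW.
Qed.

Lemma wsum_fp_gt0 k q : 0 < q -> 0 < wsum lam x k (q * nfp q) (mfp q).
Proof.
move=> q0; have n0 := nfp_gt0 (ltW q0); have m0 := mfp_gt0 (ltW q0).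
apply: (wsum_gt0 _ lam_j0 x_j0); rewrite ?mulr_ge0 ?addr_gt0 ?mulr_gt0// ltW//.
Qed.

Lemma Hfp_gt0 q : 0 < q -> 0 < Hfp q.
Proof.
move=> q0; rewrite divr_gt0// mulr_gt0 ?exprn_gt0 ?wsum_fp_gt0//.
  exact/mfp_gt0/ltW.
exact/nfp_gt0/ltW.
Qed.

(** H is the product of (mfp / nfp)^2 and S1 / S2. The first factor increases strictly because c < 1
    ([mn]). The second is nondecreasing because lam_eff decreases in q ([ab]) and rho is
    nondecreasing in lam_eff ([ws]). *)
Lemma Hfp_lt p q : 0 < p -> p < q -> Hfp p < Hfp q.
Proof.
move=> p0 pq; have q0 := lt_trans p0 pq.
have np := nfp_gt0 (ltW p0); have nq := nfp_gt0 (ltW q0).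
have mp := mfp_gt0 (ltW p0); have mq := mfp_gt0 (ltW q0).
have s1p := wsum_fp_gt0 1 p0; have s2p := wsum_fp_gt0 2 p0.
have s1q := wsum_fp_gt0 1 q0; have s2q := wsum_fp_gt0 2 q0.
have mn : mfp p * nfp q < mfp q * nfp p.
  rewrite -subr_gt0 (_ : _ - _ = delta ^+ 2 * ((q - p) * (1 - c ^+ 2))).
    by rewrite mulr_gt0// mulr_gt0// subr_gt0.
  by rewrite /mfp /nfp; ring.
have ab : p * nfp p * mfp q <= q * nfp q * mfp p.
  rewrite -subr_ge0 (_ : _ - _ = (q - p) * (delta ^+ 3 * c * p * q
      + delta ^+ 2 * c ^+ 2 * (p + q) + delta * c)).
    have d3 : 0 < delta ^+ 3 by exact: exprn_gt0.
    rewrite mulr_ge0 ?subr_ge0 1?ltW//.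
    by rewrite !addr_gt0 ?mulr_gt0 ?exprn_gt0 ?addr_gt0.
  by rewrite /mfp /nfp; ring.
have ws : S2 q * S1 p <= S2 p * S1 q.
  by apply: wsum_mono; rewrite ?mulr_ge0 ?addr_gt0 ?mulr_gt0// ltW.
rewrite /Hfp ltr_pdivrMr ?mulr_gt0 ?exprn_gt0// [ltRHS]mulrAC.
rewrite ltr_pdivlMr ?mulr_gt0 ?exprn_gt0//.
rewrite (_ : mfp p ^+ 2 * S1 p * (nfp q ^+ 2 * S2 q)
  = (mfp p * nfp q) ^+ 2 * (S2 q * S1 p)); last by ring.
rewrite (_ : mfp q ^+ 2 * S1 q * (nfp p ^+ 2 * S2 p)
  = (mfp q * nfp p) ^+ 2 * (S2 p * S1 q)); last by ring.
apply: (@le_lt_trans _ _ ((mfp p * nfp q) ^+ 2 * (S2 p * S1 q))).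
  by rewrite ler_wpM2l ?sqr_ge0.
by rewrite ltr_pM2r ?mulr_gt0// ltrXn2r// ltW// mulr_gt0.
Qed.

Lemma Hfp_le p q : 0 < p -> p <= q -> Hfp p <= Hfp q.
Proof. by move=> p0; rewrite le_eqVlt => /predU1P[->//|/(Hfp_lt p0)/ltW]. Qed.

Lemma Hfp_inj p q : 0 < p -> 0 < q -> Hfp p = Hfp q -> p = q.
Proof.
move=> p0 q0 e; case: (ltgtP p q) => // [/(Hfp_lt p0)|/(Hfp_lt q0)];
  by rewrite e ltxx.
Qed.

(** Together with [mfp_gt], this places t(q) strictly between its limits delta c at 0 and delta / c
    at infinity. *)
Lemma mfp_lt q : 0 < q -> c * mfp q < delta * nfp q.
Proof.
move=> q0; rewrite -subr_gt0 (_ : _ - _ = delta * (1 - c ^+ 2)).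
  by rewrite mulr_gt0// subr_gt0.
by rewrite /mfp /nfp; ring.
Qed.

Lemma mfp_gt q : 0 < q -> delta * c * nfp q < mfp q.
Proof.
move=> q0; rewrite -subr_gt0 (_ : _ - _ = delta ^+ 2 * (q * (1 - c ^+ 2))).
  by rewrite mulr_gt0// mulr_gt0// subr_gt0.
by rewrite /mfp /nfp; ring.
Qed.

(** The hypothesis says that the limit of H at infinity, where lam_eff tends to 0, is at most 1.
    Since t < delta / c is strict, H stays below 1 even when that limit equals 1. *)
Lemma Hfp_lt1 q : 0 < q ->
  delta ^+ 2 * wsum lam x 1 1 0 <= c ^+ 2 * wsum lam x 2 1 0 -> Hfp q < 1.
Proof.
move=> q0 dm.
have n0 := nfp_gt0 (ltW q0); have m0 := mfp_gt0 (ltW q0).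
have s1 := wsum_fp_gt0 1 q0; have s2 := wsum_fp_gt0 2 q0.
have e1 : 0 < wsum lam x 1 1 0.
  by apply: (wsum_gt0 _ lam_j0 x_j0); rewrite ?addr0.
have e2 : 0 < wsum lam x 2 1 0.
  by apply: (wsum_gt0 _ lam_j0 x_j0); rewrite ?addr0.
rewrite /Hfp ltr_pdivrMr ?mul1r ?mulr_gt0 ?exprn_gt0//.
have ws : wsum lam x 2 1 0 * S1 q <= S2 q * wsum lam x 1 1 0.
  by apply: wsum_mono; rewrite ?mulr0 ?mul1r ?addr0 ?addr_gt0 ?mulr_gt0//
    ?mulr_ge0 ?(ltW m0) ?(ltW n0) ?(ltW q0).
rewrite -(@ltr_pM2l _ (c ^+ 2 * wsum lam x 2 1 0)) ?mulr_gt0 ?exprn_gt0//.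
rewrite (_ : _ * (_ * S1 q) =
  (c * mfp q) ^+ 2 * (wsum lam x 2 1 0 * S1 q)); last by ring.
apply: (@le_lt_trans _ _ ((c * mfp q) ^+ 2 * (S2 q * wsum lam x 1 1 0))).
  by rewrite ler_wpM2l ?sqr_ge0.
apply: (@lt_le_trans _ _ ((delta * nfp q) ^+ 2 * (S2 q * wsum lam x 1 1 0))).
  by rewrite ltr_pM2r ?mulr_gt0// ltrXn2r ?mfp_lt// mulr_ge0 ?ltW.
rewrite (_ : _ * (_ * _) =
  (nfp q ^+ 2 * S2 q) * (delta ^+ 2 * wsum lam x 1 1 0)); last by ring.
by rewrite [leRHS]mulrC ler_wpM2l// mulr_ge0 ?sqr_ge0 ?ltW.
Qed.

(** Mirror image at q = 0: the endpoint (0, 1) stands for infinite regularisation, and t > delta c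
    is strict. *)
Lemma Hfp_gt1 q : 0 < q ->
  wsum lam x 2 0 1 <= (delta * c) ^+ 2 * wsum lam x 1 0 1 -> 1 < Hfp q.
Proof.
move=> q0 dm.
have n0 := nfp_gt0 (ltW q0); have m0 := mfp_gt0 (ltW q0).
have s1 := wsum_fp_gt0 1 q0; have s2 := wsum_fp_gt0 2 q0.
have e1 : 0 < wsum lam x 1 0 1.
  by apply: (wsum_gt0 _ lam_j0 x_j0); rewrite ?add0r.
rewrite /Hfp ltr_pdivlMr ?mul1r ?mulr_gt0 ?exprn_gt0//.
have ws : S2 q * wsum lam x 1 0 1 <= wsum lam x 2 0 1 * S1 q.
  by apply: wsum_mono; rewrite ?mul0r ?mulr1 ?add0r ?addr_gt0 ?mulr_gt0//
    ?mulr_ge0 ?(ltW m0) ?(ltW n0) ?(ltW q0).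
rewrite -(@ltr_pM2r _ (wsum lam x 1 0 1))// -mulrA.
apply: (@le_lt_trans _ _ (nfp q ^+ 2 * (wsum lam x 2 0 1 * S1 q))).
  by rewrite ler_wpM2l ?sqr_ge0.
apply: (@le_lt_trans _ _
  (nfp q ^+ 2 * ((delta * c) ^+ 2 * wsum lam x 1 0 1 * S1 q))).
  by rewrite ler_wpM2l ?sqr_ge0// ler_wpM2r// ltW.
rewrite (_ : _ * (_ * _) =
  (delta * c * nfp q) ^+ 2 * S1 q * wsum lam x 1 0 1); last by ring.
by rewrite ltr_pM2r// ltr_pM2r// ltrXn2r ?mfp_gt// mulr_ge0 ?ltW.
Qed.

(** The intermediate value theorem, applied to a function [f] on [0, 1] that has the sign of H - 1
    inside and whose endpoint signs are the two hypotheses. *)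
Lemma Hfp_root :
  c ^+ 2 * wsum lam x 2 1 0 < delta ^+ 2 * wsum lam x 1 1 0 ->
  (delta * c) ^+ 2 * wsum lam x 1 0 1 < wsum lam x 2 0 1 ->
  exists2 q, 0 < q & Hfp q = 1.
Proof.
move=> dm dp.
(* [t = q / (1 + q)] compactifies the range of [q]. *)
pose n t : R := (1 - t) + delta * c * t.
pose m t : R := delta ^+ 2 * t + delta * c * (1 - t).
(* [n t] and [m t] are (1 - t) times [nfp q] and [mfp q], and the pair used here is (1 - t)^2 times
   [(q * nfp q, mfp q)]; unlike the latter, it remains finite and nonzero at t = 1. *)
pose f t := m t ^+ 2 * wsum lam x 1 (t * n t) ((1 - t) * m t)
  - n t ^+ 2 * wsum lam x 2 (t * n t) ((1 - t) * m t).
have n_gt0 (t : R) : 0 <= t <= 1 -> 0 < n t.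
  move=> /andP[t0]; rewrite -subr_ge0 le_eqVlt => /predU1P[e|t1].
    by rewrite /n -e add0r mulr_gt0// (_ : t = 1) //; lra.
  by rewrite /n ltr_pwDl// mulr_ge0// ltW.
have m_gt0 (t : R) : 0 <= t <= 1 -> 0 < m t.
  move=> /andP[t0]; rewrite -subr_ge0 le_eqVlt => /predU1P[e|t1].
    by rewrite /m -e mulr0 addr0 mulr_gt0// (_ : t = 1) //; lra.
  by rewrite /m ltr_wpDl ?mulr_gt0// mulr_ge0// ltW.
have cf : {within `[0, 1], continuous f}.
  apply: continuous_in_subspaceT => t; rewrite inE/= in_itv/= => t01.
  have nt := n_gt0 _ t01; have mt := m_gt0 _ t01; case/andP : (t01) => t0 t1.
  have cn : {for t, continuous n}.
    by apply: cvgD; [apply: cvgB; [exact: cvg_cst|exact: cvg_id] |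
      apply: cvgM; [exact: cvg_cst|exact: cvg_id]].
  have c1 : {for t, continuous (fun s : R => 1 - s)}.
    by apply: cvgB; [exact: cvg_cst|exact: cvg_id].
  have cm : {for t, continuous m}.
    by apply: cvgD; apply: cvgM => //; (exact: cvg_cst || exact: cvg_id).
  have ab : 0 < t * n t + (1 - t) * m t.
    move: t0; rewrite le_eqVlt => /predU1P[<-|t_gt0].
      by rewrite mul0r add0r subr0 mul1r m_gt0// lexx ler01.
    by rewrite ltr_pwDl ?mulr_gt0// mulr_ge0 ?subr_ge0// ltW.
  have cw k : {for t, continuous
      (fun s : R => wsum lam x k (s * n s) ((1 - s) * m s))}.
    apply: (@cvg_big R _ +%R 0 _ (@add_continuous _)) => j lj.
    apply: cvgM; first exact: cvg_cst.
    have D0 : 0 < lam j * (t * n t) + (1 - t) * m t.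
      by rewrite affine_gt0// mulr_ge0 ?subr_ge0// ltW.
    apply: cvgV; first by rewrite gt_eqF// exprn_gt0.
    rewrite expr2; under eq_fun do rewrite expr2.
    by apply: cvgM; (apply: cvgD; last by apply: cvgM);
      (apply: cvgM; first exact: cvg_cst);
      apply: cvgM; (exact: cvg_id || exact: cn).
  rewrite /f /continuous_at !expr2; under eq_fun do rewrite !expr2.
  by apply: cvgB; (apply: cvgM; [apply: cvgM|exact: cw]).
have f0 : f 0 < 0.
  have e k : wsum lam x k 0 (delta * c) = wsum lam x k 0 1 / (delta * c) ^+ 2.
    by rewrite -wsum_scale mulr0 mulr1.
  rewrite /f /m /n !(mulr0, mul0r, subr0, mulr1, mul1r, add0r, addr0).
  rewrite expr1n mul1r !e mulrA -mulrBl pmulr_llt0 ?invr_gt0 ?exprn_gt0//.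
  by rewrite subr_lt0.
have f1 : 0 < f 1.
  have e k : wsum lam x k (delta * c) 0 = wsum lam x k 1 0 / (delta * c) ^+ 2.
    by rewrite -wsum_scale mulr0 mulr1.
  rewrite /f /m /n subrr !(mulr0, mul0r, mulr1, mul1r, add0r, addr0) !e !mulrA.
  rewrite -mulrBl divr_gt0 ?exprn_gt0// subr_gt0.
  (* At t = 1, n = delta c and m = delta^2, so the sign of [f 1] is [dm] multiplied by delta^2. *)
  rewrite -(ltr_pM2l d2_gt0) in dm.
  by apply: etrans dm; congr (_ < _); ring.
have [t] : exists2 t, t \in `[0, 1] & f t = 0.
  by apply: (IVT ler01 cf); rewrite ge_min le_max (ltW f0) (ltW f1) orbT.
rewrite in_itv/= => t01 ft.
have tn0 : t != 0 by apply/eqP => e; rewrite e in ft; rewrite ft ltxx in f0.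
have tn1 : t != 1 by apply/eqP => e; rewrite e in ft; rewrite ft ltxx in f1.
have nt := n_gt0 _ t01; have mt := m_gt0 _ t01.
have t0 : 0 < t by rewrite lt_neqAle eq_sym tn0; case/andP: t01.
have t1 : 0 < 1 - t by rewrite subr_gt0 lt_neqAle tn1; case/andP: t01.
pose q := t / (1 - t); have q0 : 0 < q by rewrite divr_gt0.
have nE : nfp q = n t / (1 - t).
  by rewrite /nfp /n /q; field; rewrite gt_eqF.
have mE : mfp q = m t / (1 - t).
  by rewrite /mfp /m /q; field; rewrite gt_eqF.
have wE k : wsum lam x k (q * nfp q) (mfp q)
    = wsum lam x k (t * n t) ((1 - t) * m t) / ((1 - t) ^- 2) ^+ 2.
  rewrite -wsum_scale; congr wsum; rewrite ?nE ?mE /q.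
    by field; rewrite gt_eqF.
  by field; rewrite gt_eqF.
have W2 : 0 < wsum lam x 2 (t * n t) ((1 - t) * m t).
  have := wsum_fp_gt0 2 q0; rewrite wE pmulr_lgt0// invr_gt0 exprn_gt0//.
  by rewrite invr_gt0 exprn_gt0.
exists q => //; rewrite /Hfp !wE nE mE.
rewrite /f in ft; move/eqP: ft; rewrite subr_eq0 => /eqP ft.
set W := wsum lam x 2 _ _ in W2 ft *; set V := wsum lam x 1 _ _ in ft *.
transitivity ((m t ^+ 2 * V) / (n t ^+ 2 * W)).
  by field; rewrite !gt_eqF.
by rewrite ft divff// gt_eqF// mulr_gt0// exprn_gt0.
Qed.

(** * The fixed point equation at positive learning rate *)

Lemma sum_lam_pos (F : 'I_d -> R) : (forall j, lam j = 0 -> F j = 0) ->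
  \sum_(j | 0 < lam j) F j = \sum_j F j.
Proof.
move=> F0; rewrite big_mkcond; apply: eq_bigr => j _; case: ifPn => //.
rewrite -leNgt => lj; rewrite F0//.
by apply/eqP; rewrite eq_le lj lam_ge0.
Qed.

Lemma Finfty_wsum q : 0 < q -> 2 * Finfty delta lam x q = mfp q ^+ 2 * S1 q.
Proof.
move=> q0; have n0 := nfp_gt0 (ltW q0); have m0 := mfp_gt0 (ltW q0).
rewrite /Finfty /wsum mulrA divff ?pnatr_eq0// mul1r mulr_sumr.
rewrite sum_lam_pos => [|j ->]; last first.
  by rewrite expr0n/= !mul0r mulr0.
apply: eq_bigr => j _; rewrite lam_effE//.
have D0 : 0 < lam j * (q * nfp q) + mfp q.
  by rewrite ltr_wpDl// !mulr_ge0 ?(ltW q0)// ltW.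
have -> : lam j + mfp q / (q * nfp q)
    = (lam j * (q * nfp q) + mfp q) / (q * nfp q).
  by field; rewrite !gt_eqF.
by field; rewrite ?(gt_eqF D0) !gt_eqF.
Qed.

Lemma Linfty_wsum q : 0 < q -> Linfty delta lam x q = (q * nfp q) ^+ 2 * S2 q.
Proof.
move=> q0; have n0 := nfp_gt0 (ltW q0); have m0 := mfp_gt0 (ltW q0).
rewrite /Linfty /wsum mulr_sumr.
rewrite sum_lam_pos => [|j ->]; last first.
  by rewrite expr0n/= !mul0r mulr0.
apply: eq_bigr => j _; rewrite lam_effE//.
have D0 : 0 < lam j * (q * nfp q) + mfp q.
  by rewrite ltr_wpDl// !mulr_ge0 ?(ltW q0)// ltW.
have -> : lam j + mfp q / (q * nfp q)
    = (lam j * (q * nfp q) + mfp q) / (q * nfp q).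
  by field; rewrite !gt_eqF.
by field; rewrite ?(gt_eqF D0) !gt_eqF.
Qed.

(** Move the C_B term to the left and divide by L / (2 F) = q^2 / H. *)
Lemma fixed_point_Hfp gam q : 0 < q -> fixed_point gam delta lam x q ->
  Hfp q * (1 - Gfp delta q * CB gam delta lam q / (2 * q ^+ 2))
    = 1 - Gfp delta q * CR gam delta lam q.
Proof.
move=> q0; rewrite /fixed_point Finfty_wsum// Linfty_wsum//.
have n0 := nfp_gt0 (ltW q0); have m0 := mfp_gt0 (ltW q0).
have := wsum_fp_gt0 1 q0; have := wsum_fp_gt0 2 q0; rewrite /Hfp.
set w2 := wsum _ _ 2 _ _; set w1 := wsum _ _ 1 _ _; move=> w20 w10.
move: (Gfp _ _) (CR _ _ _ _) (CB _ _ _ _) => G A B e.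
have -> : 1 - G * B / (2 * q ^+ 2) = (q ^+ 2 - 2^-1 * G * B) / q ^+ 2.
  by field; rewrite gt_eqF.
by rewrite {1}e; field; rewrite !gt_eqF.
Qed.

Lemma Gfp_ge0 q : 0 <= q -> 0 <= Gfp delta q.
Proof.
by move=> q0; rewrite /Gfp !addr_ge0 ?mulr_ge0 ?sqr_ge0// ltW.
Qed.

(** A lower bound on the denominators uniform in q and in the eigenvalue; it makes the sums in C_R
    and C_B bounded independently of q. *)
Lemma Dfp_ge j q : 0 < q -> delta ^+ 2 <= Dfp delta (lam j) q.
Proof.
move=> q0; rewrite /Dfp -/(nfp q) addrAC lerDr addr_ge0//.
  by rewrite mulr_ge0// ltW// nfp_gt0// ltW.
by rewrite mulr_ge0 ?invr_ge0// ltW.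
Qed.

Lemma sum_Dfp_le k q : 0 < q ->
  0 <= \sum_j lam j ^+ k / Dfp delta (lam j) q
    <= \sum_j lam j ^+ k / delta ^+ 2.
Proof.
move=> q0; apply/andP; split.
  apply: sumr_ge0 => j _; rewrite divr_ge0 ?exprn_ge0//.
  exact: le_trans (ltW d2_gt0) (Dfp_ge j q0).
apply: ler_sum => j _; rewrite ler_wpM2l ?exprn_ge0// lef_pV2 ?posrE//.
  exact: Dfp_ge.
exact: lt_le_trans d2_gt0 (Dfp_ge j q0).
Qed.

(** In H (1 - e) = 1 - g the correction e is nonnegative, so H >= 1 - g; and g is bounded on q <= M
    because G increases. *)
Lemma fixed_point_ge gam q M : 0 < gam -> 0 < q -> q <= M ->
  fixed_point gam delta lam x q ->
  1 - gam * (Gfp delta M * ((2 * d%:R)^-1 * \sum_j lam j ^+ 2 / delta ^+ 2))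
    <= Hfp q.
Proof.
move=> g0 q0 qM /(fixed_point_Hfp q0) e.
have G0 := Gfp_ge0 (ltW q0); have /andP[s0 s1] := sum_Dfp_le 2 q0.
have K0 : 0 <= (2 * d%:R)^-1 :> R by rewrite invr_ge0 mulr_ge0.
apply: (@le_trans _ _ (1 - Gfp delta q * CR gam delta lam q)).
  rewrite lerD2l lerN2 /CR -[gam / _ * _]mulrA mulrCA ler_pM2l//.
  apply: ler_pM => //; first by rewrite mulr_ge0.
    by rewrite /Gfp; apply: lerD; [apply: lerD|];
      rewrite ?ler_wpM2l ?lerXn2r ?nnegrE ?mulr_ge0 ?sqr_ge0 ?(ltW delta_gt0)
        ?(ltW c_gt0) ?(ltW q0) ?(le_trans (ltW q0) qM).
  by rewrite ler_wpM2l.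
rewrite -e ler_piMr ?(ltW (Hfp_gt0 q0))// gerBl /CB.
have /andP[s10 _] := sum_Dfp_le 1 q0.
apply: divr_ge0; last by rewrite mulr_ge0 ?sqr_ge0.
apply: mulr_ge0 => //; apply: mulr_ge0; first by rewrite divr_ge0// ltW.
by under eq_bigr do rewrite -[lam _]expr1.
Qed.

(** Here g >= 0 is dropped instead. The bound on e holds on q >= eps because G(q) / q^2 is a
    polynomial in 1 / q with nonnegative coefficients, hence decreases in q. *)
Lemma fixed_point_le gam q eps : 0 < gam -> 0 < eps -> eps <= q ->
  fixed_point gam delta lam x q ->
  Hfp q * (1 - gam * (Gfp delta eps / eps ^+ 2
      * ((2 * d%:R)^-1 * \sum_j lam j ^+ 1 / delta ^+ 2))) <= 1.
Proof.
move=> g0 eps0 epsq; have q0 := lt_le_trans eps0 epsq.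
move=> /(fixed_point_Hfp q0) e.
have G0 := Gfp_ge0 (ltW q0).
have K0 : 0 <= (2 * d%:R)^-1 :> R by rewrite invr_ge0 mulr_ge0.
have /andP[s10 s11] := sum_Dfp_le 1 q0; have /andP[s20 _] := sum_Dfp_le 2 q0.
apply: (@le_trans _ _ (1 - Gfp delta q * CR gam delta lam q)); last first.
  rewrite gerBl; apply: mulr_ge0 => //; apply: mulr_ge0 => //.
  by rewrite divr_ge0 ?mulr_ge0// ltW.
rewrite -e ler_pM2l ?Hfp_gt0// lerD2l lerN2 /CB.
have -> : \sum_j lam j / Dfp delta (lam j) q
    = \sum_j lam j ^+ 1 / Dfp delta (lam j) q.
  by apply: eq_bigr => j _; rewrite expr1.
rewrite (_ : _ / (2 * q ^+ 2) = gam * (Gfp delta q / q ^+ 2 *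
   ((2 * d%:R)^-1 * \sum_j lam j ^+ 1 / Dfp delta (lam j) q))); last first.
  by rewrite !invfM; ring.
rewrite ler_pM2l//; apply: ler_pM.
- by rewrite divr_ge0 ?sqr_ge0.
- by rewrite mulr_ge0.
- have GE y : 0 < y -> Gfp delta y / y ^+ 2
      = y^-1 ^+ 2 + 2 * delta * c * y^-1 + delta ^+ 2.
    by move=> y0; rewrite /Gfp; field; rewrite gt_eqF.
  have le_inv : q^-1 <= eps^-1 by rewrite lef_pV2.
  rewrite !GE// lerD2r; apply: lerD.
    by rewrite lerXn2r ?nnegrE ?invr_ge0 ?(ltW q0) ?(ltW eps0).
  by rewrite ler_wpM2l// !mulr_ge0 ?(ltW delta_gt0) ?(ltW c_gt0).
- by rewrite ler_wpM2l.
Qed.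

(* Once [gam] is small, [q <= M] would contradict [fixed_point_ge]. *)
Lemma near_admissible_gt (Gam : set R) (qinf : R -> R) (M : R) :
  (forall gam, Gam gam -> admissible_solution gam delta lam x (qinf gam)) ->
  0 < M -> Hfp M < 1 ->
  \forall gam \near within Gam 0^'+, M < qinf gam.
Proof.
move=> adm M0 HM; rewrite near_withinE.
set A := Gfp delta M * ((2 * d%:R)^-1 * \sum_j lam j ^+ 2 / delta ^+ 2).
have A0 : 0 <= A.
  rewrite mulr_ge0 ?Gfp_ge0 ?(ltW M0)// mulr_ge0 ?invr_ge0 ?mulr_ge0//.
  by apply: sumr_ge0 => j _; rewrite divr_ge0 ?exprn_ge0// ltW.
(* [A] is only known to be nonnegative; [A + 1] can serve as divisor in the threshold on [gam]. *)
have A1 : 0 < A + 1 by rewrite ltr_wpDl.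
near=> gam => Ggam; have [q0 fp _] := adm _ Ggam.
rewrite ltNge; apply/negP => qM.
(* Positivity of [gam] comes from the filter [0^'+]. *)
have g0 : 0 < gam by [].
have := le_trans (fixed_point_ge g0 q0 qM fp) (Hfp_le q0 qM).
rewrite -/A leNgt => /negP; apply; rewrite ltrBrDr -ltrBrDl.
apply: (@le_lt_trans _ _ (gam * (A + 1))); first by rewrite ler_pM2l// lerDl.
rewrite -ltr_pdivlMr//; near: gam.
by apply: nbhs_right_lt; rewrite divr_gt0// subr_gt0.
Unshelve. all: by end_near. Qed.

(** If q >= eps, then H(eps) <= H(q) and [fixed_point_le] give H(eps) (1 - gam B) <= 1, which fails
    once gam B < 1 - 1 / H(eps). *)
Lemma near_admissible_lt (Gam : set R) (qinf : R -> R) (eps : R) :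
  (forall gam, Gam gam -> admissible_solution gam delta lam x (qinf gam)) ->
  0 < eps -> 1 < Hfp eps ->
  \forall gam \near within Gam 0^'+, qinf gam < eps.
Proof.
move=> adm e0 He; rewrite near_withinE.
set B := Gfp delta eps / eps ^+ 2
  * ((2 * d%:R)^-1 * \sum_j lam j ^+ 1 / delta ^+ 2).
have B0 : 0 <= B.
  rewrite mulr_ge0 ?divr_ge0 ?Gfp_ge0 ?sqr_ge0 ?(ltW e0)//.
  rewrite mulr_ge0 ?invr_ge0 ?mulr_ge0//.
  by apply: sumr_ge0 => j _; rewrite divr_ge0 ?exprn_ge0// ltW.
have B1 : 0 < B + 1 by rewrite ltr_wpDl.
have H0 := lt_trans ltr01 He.
near=> gam => Ggam; have [q0 fp _] := adm _ Ggam.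
rewrite ltNge; apply/negP => epsq.
have g0 : 0 < gam by [].
have gB : gam * B < 1 - (Hfp eps)^-1.
  apply: (@le_lt_trans _ _ (gam * (B + 1))); first by rewrite ler_pM2l// lerDl.
  rewrite -ltr_pdivlMr//; near: gam.
  by apply: nbhs_right_lt; rewrite divr_gt0// subr_gt0 invf_lt1.
have := fixed_point_le g0 e0 epsq fp.
rewrite -/B leNgt => /negP; apply.
have gB1 : (Hfp eps)^-1 < 1 - gam * B by rewrite ltrBrDr -ltrBrDl.
apply: (@lt_le_trans _ _ (Hfp eps * (1 - gam * B))).
  by rewrite -ltr_pdivrMl ?mulr1.
by rewrite ler_wpM2r ?Hfp_le// ltW// (lt_trans _ gB1)// invr_gt0.
Unshelve. all: by end_near. Qed.

(** * The effective regularisation and the limit system *)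

Lemma lam_eff_gt0 q : 0 < q -> 0 < lam_eff delta q.
Proof.
move=> q0; have n0 := nfp_gt0 (ltW q0); have m0 := mfp_gt0 (ltW q0).
by rewrite lam_effE// divr_gt0 ?mulr_gt0.
Qed.

(** The upper bound on t(q) divided by q; it forces lam_eff to 0 as q tends to infinity, while
    [lam_eff_gt] forces it to infinity as q tends to 0. *)
Lemma lam_eff_lt q : 0 < q -> lam_eff delta q < delta / c / q.
Proof.
move=> q0; have n0 := nfp_gt0 (ltW q0).
rewrite lam_effE// ltr_pdivrMr ?mulr_gt0//.
have -> : delta / c / q * (q * nfp q) = delta * nfp q / c.
  by field; rewrite !gt_eqF.
by rewrite ltr_pdivlMr// mulrC mfp_lt.
Qed.

Lemma lam_eff_gt q : 0 < q -> delta * c / q < lam_eff delta q.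
Proof.
move=> q0; have n0 := nfp_gt0 (ltW q0).
rewrite lam_effE// ltr_pdivlMr ?mulr_gt0//.
have -> : delta * c / q * (q * nfp q) = delta * c * nfp q.
  by field; rewrite gt_eqF.
exact: mfp_gt.
Qed.

(** The two sums are L and 2 F, and H was defined so that L / (2 F) = q^2 / H. *)
Lemma limit_ratioE q : 0 < q ->
  (\sum_(j | 0 < lam j)
      lam j ^+ 2 / (lam j + lam_eff delta q) ^+ 2 * x j ^+ 2)
   / (\sum_(j | 0 < lam j)
      lam j * (lam_eff delta q ^+ 2 / (lam j + lam_eff delta q) ^+ 2)
        * x j ^+ 2)
  = q ^+ 2 / Hfp q.
Proof.
move=> q0; have n0 := nfp_gt0 (ltW q0); have m0 := mfp_gt0 (ltW q0).
have s1 := wsum_fp_gt0 1 q0; have s2 := wsum_fp_gt0 2 q0.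
have -> : \sum_(j | 0 < lam j)
      lam j ^+ 2 / (lam j + lam_eff delta q) ^+ 2 * x j ^+ 2
    = (q * nfp q) ^+ 2 * S2 q.
  rewrite -Linfty_wsum// sum_lam_pos => [|j ->]; last first.
    by rewrite expr0n/= !mul0r.
  by apply: eq_bigr => j _; rewrite [in RHS]expr_div_n.
have -> : \sum_(j | 0 < lam j)
      lam j * (lam_eff delta q ^+ 2 / (lam j + lam_eff delta q) ^+ 2)
        * x j ^+ 2
    = mfp q ^+ 2 * S1 q.
  rewrite -Finfty_wsum// /Finfty mulrA divff ?pnatr_eq0// mul1r.
  rewrite sum_lam_pos => [|j ->]; last by rewrite !mul0r.
  by apply: eq_bigr => j _; rewrite [in RHS]expr_div_n.
by rewrite /Hfp; field; rewrite !gt_eqF.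
Qed.

Lemma limit_systemP q l : 0 < q ->
  limit_system delta lam x q l <-> Hfp q = 1 /\ l = lam_eff delta q.
Proof.
move=> q0; have H0 := Hfp_gt0 q0; split.
(* [cpi] unfolds to the square root of 2 / pi, so the second equation is the definition of [lam_eff]
   by conversion. *)
- case=> + lE; have {}lE : l = lam_eff delta q by [].
  rewrite lE limit_ratioE// => /(congr1 (fun y => y ^+ 2)).
  rewrite sqr_sqrtr => [/eqP|]; last exact: divr_ge0 (sqr_ge0 _) (ltW H0).
  rewrite eq_sym -subr_eq0 -[X in _ - X]mulr1 -mulrBr mulf_eq0 sqrf_eq0.
  by rewrite gt_eqF//= subr_eq0 invr_eq1 => /eqP.
- case=> H1 ->; split=> //.
  by rewrite limit_ratioE// H1 divr1 sqrtr_sqr gtr0_norm.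
Qed.

(** * The thresholds as endpoint inequalities for H *)

Lemma le_mul_sqrt (k A B : R) : 0 < k -> 0 < A -> 0 < B ->
  (delta <= k * Num.sqrt (A / B)) = (delta ^+ 2 * B <= k ^+ 2 * A).
Proof.
move=> k0 A0 B0; have kAB : 0 <= k * Num.sqrt (A / B).
  by rewrite mulr_ge0 ?sqrtr_ge0// ltW.
rewrite -ler_sqr ?nnegrE// ?(ltW delta_gt0)// exprMn.
by rewrite sqr_sqrtr ?divr_ge0 ?(ltW A0) ?(ltW B0)// mulrA ler_pdivlMr.
Qed.

Lemma ge_mul_sqrt (k A B : R) : 0 < k -> 0 < A -> 0 < B ->
  (k * Num.sqrt (A / B) <= delta) = (k ^+ 2 * A <= delta ^+ 2 * B).
Proof.
move=> k0 A0 B0; have kAB : 0 <= k * Num.sqrt (A / B).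
  by rewrite mulr_ge0 ?sqrtr_ge0// ltW.
rewrite -ler_sqr ?nnegrE// ?(ltW delta_gt0)// exprMn.
by rewrite sqr_sqrtr ?divr_ge0 ?(ltW A0) ?(ltW B0)// mulrA ler_pdivrMr.
Qed.

Lemma wsum10E : wsum lam x 2 1 0 = \sum_(j | 0 < lam j) x j ^+ 2 /\
  wsum lam x 1 1 0 = \sum_(j | 0 < lam j) x j ^+ 2 / lam j.
Proof.
split; apply: eq_bigr => j lj; rewrite mulr1 addr0.
  by field; rewrite gt_eqF.
by field; rewrite gt_eqF.
Qed.

Lemma wsum01E : wsum lam x 2 0 1 = \sum_(j | 0 < lam j) lam j ^+ 2 * x j ^+ 2 /\
  wsum lam x 1 0 1 = \sum_(j | 0 < lam j) lam j * x j ^+ 2.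
Proof. by split; apply: eq_bigr => j lj; rewrite mulr0 add0r expr1n divr1. Qed.

(** Squaring turns the threshold into the hypothesis of [Hfp_lt1]; its negation is the first
    hypothesis of [Hfp_root]. [ge_delta_plus] does the same for the other endpoint. *)
Lemma le_delta_minus : (delta <= delta_minus lam x) =
  (delta ^+ 2 * wsum lam x 1 1 0 <= c ^+ 2 * wsum lam x 2 1 0).
Proof.
rewrite /delta_minus -wsum10E.1 -wsum10E.2 le_mul_sqrt//;
  by apply: (wsum_gt0 _ lam_j0 x_j0); rewrite ?addr0.
Qed.

Lemma sqrt_pihalf : Num.sqrt (pi / 2) = c^-1.
Proof. by rewrite -invf_div sqrtrV// divr_ge0// pi_ge0. Qed.

Lemma ge_delta_plus : (delta_plus lam x <= delta) =
  (wsum lam x 2 0 1 <= (delta * c) ^+ 2 * wsum lam x 1 0 1).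
Proof.
rewrite /delta_plus -wsum01E.1 -wsum01E.2 sqrt_pihalf ge_mul_sqrt ?invr_gt0//;
  try by apply: (wsum_gt0 _ lam_j0 x_j0); rewrite ?add0r.
by rewrite mulrC exprVn ler_pdivrMr ?exprn_gt0// exprMn mulrAC.
Qed.

(** * Limits as the learning rate tends to 0 *)

Section Limits.
Variables (Gam : set R) (qinf : R -> R).
Hypothesis adm : forall gam, Gam gam ->
  admissible_solution gam delta lam x (qinf gam).

Let Gam_near : \forall gam \near within Gam 0^'+, 0 < qinf gam.
Proof.
by rewrite near_withinE; apply: nearW => gam /adm[].
Qed.

Lemma cvg_le_delta_minus : delta <= delta_minus lam x ->
  qinf gam @[gam --> within Gam 0^'+] --> +oo /\
  lam_eff delta (qinf gam) @[gam --> within Gam 0^'+] --> (0 : R).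
Proof.
rewrite le_delta_minus => dm.
have qgt M : 0 < M -> \forall gam \near within Gam 0^'+, M < qinf gam.
  by move=> M0; apply: near_admissible_gt => //; exact: Hfp_lt1.
split.
  apply/cvgryPgt => M.
  (* H is controlled at positive arguments only, hence the maximum with 1. *)
  have M1 : 0 < Num.max M 1 by rewrite lt_max ltr01 orbT.
  by apply: filterS (qgt _ M1) => gam; rewrite gt_max => /andP[].
(* By [lam_eff_lt], q > delta / (c e) implies lam_eff < e. *)
apply/cvgrPdist_lt => e e0; have e1 : 0 < delta / c / e by rewrite !divr_gt0.
apply: filterS (qgt _ e1) => gam qe; have q0 := lt_trans e1 qe.
rewrite sub0r normrN gtr0_norm ?lam_eff_gt0//.
apply: (lt_trans (lam_eff_lt q0)).
by rewrite ltr_pdivrMr// [ltRHS]mulrC -ltr_pdivrMr.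
Qed.

Lemma cvg_ge_delta_plus : delta_plus lam x <= delta ->
  qinf gam @[gam --> within Gam 0^'+] --> (0 : R) /\
  lam_eff delta (qinf gam) @[gam --> within Gam 0^'+] --> +oo.
Proof.
rewrite ge_delta_plus => dp.
have qlt e : 0 < e -> \forall gam \near within Gam 0^'+, qinf gam < e.
  by move=> e0; apply: near_admissible_lt => //; exact: Hfp_gt1.
split.
  apply/cvgrPdist_lt => e e0.
  apply: filterS2 (qlt _ e0) Gam_near => gam qe q0.
  by rewrite sub0r normrN gtr0_norm.
apply/cvgryPgt => M.
have M1 : 0 < Num.max M 1 by rewrite lt_max ltr01 orbT.
have e0 : 0 < delta * c / Num.max M 1 by rewrite divr_gt0.
apply: filterS2 (qlt _ e0) Gam_near => gam qe q0.
apply: lt_trans (lam_eff_gt q0); rewrite ltr_pdivlMr//.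
move: qe; rewrite ltr_pdivlMr// mulrC; apply: le_lt_trans.
by rewrite ler_pM2r// le_max lexx.
Qed.

(** H is below 1 to the left of its root and above 1 to the right, so admissible solutions are
    trapped in every neighbourhood of the root; continuity of [lam_eff] gives the second limit. *)
Lemma cvg_Hfp1 q : 0 < q -> Hfp q = 1 ->
  qinf gam @[gam --> within Gam 0^'+] --> q /\
  lam_eff delta (qinf gam) @[gam --> within Gam 0^'+] --> lam_eff delta q.
Proof.
move=> q0 Hq.
have cq : qinf gam @[gam --> within Gam 0^'+] --> q.
  apply/cvgrPdist_lt => e e0.
  (* The term q / 2 keeps [M] positive when e >= q. *)
  pose M := Num.max (q - e) (q / 2).
  have M0 : 0 < M by rewrite lt_max divr_gt0// orbT.
  have Mq : M < q.
    by rewrite gt_max gtrBl e0 ltr_pdivrMr// mulr_natr mulr2n ltrDl.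
  have H1 : Hfp M < 1 by rewrite -Hq Hfp_lt.
  have H2 : 1 < Hfp (q + e) by rewrite -Hq Hfp_lt// ltrDl.
  have qe0 : 0 < q + e by rewrite addr_gt0.
  apply: filterS2 (near_admissible_gt adm M0 H1)
    (near_admissible_lt adm qe0 H2) => gam.
  rewrite gt_max => /andP[q1 _] q2.
  by rewrite distrC ltr_distl q1 q2.
split=> //; apply: (@cvg_comp _ _ _ qinf (lam_eff delta) _ _ _ cq).
apply: cvgM.
  apply: cvgD; first exact: cvg_cst.
  by apply: cvgM; [exact: cvg_cst|apply: cvgV; [rewrite gt_eqF|exact: cvg_id]].
apply: cvgV; first by rewrite gt_eqF// nfp_gt0// ltW.
by apply: cvgD; [exact: cvg_cst|apply: cvgM; [exact: cvg_cst|exact: cvg_id]].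
Qed.

End Limits.

(** With all eigenvalues equal to 1, S1 = S2 and H reduces to (mfp / nfp)^2, a square of a positive
    number. *)
Lemma Hfp_isotropic q : 0 < q -> (forall j, lam j = 1) -> Hfp q = 1 ->
  mfp q = nfp q.
Proof.
move=> q0 lam1; have s2 := wsum_fp_gt0 2 q0; have n0 := nfp_gt0 (ltW q0).
have m0 := mfp_gt0 (ltW q0).
have S12 : S1 q = S2 q.
  by apply: eq_bigr => j _; rewrite lam1 !expr1n.
rewrite /Hfp S12 => /(congr1 ( *%R^~ (nfp q ^+ 2 * S2 q))).
rewrite mul1r divfK ?gt_eqF ?mulr_gt0 ?exprn_gt0//.
move=> /(mulIf (negbT (gt_eqF s2)))/eqP.
by rewrite eqrXn2 ?(ltW m0) ?(ltW n0)// => /eqP.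
Qed.

End FixedPoint.

(** * Spectral decomposition of K *)

Section Spectral.
Variables (R : realType) (d : nat) (K : 'M[R]_d) (lam : 'I_d -> R).
Variable omega : 'I_d -> 'cV[R]_d.
Hypothesis eigen : orthonormal_eigenpairs K lam omega.

Let dotp_omega j : dotp (omega j) (omega j) = 1.
Proof. by rewrite eigen.2 eqxx. Qed.

Lemma eigenpair_dotp (v : 'cV[R]_d) j :
  dotp v (K *m omega j) = lam j * dotp v (omega j).
Proof. by rewrite eigen.1 /dotp -scalemxAr mxE. Qed.

Lemma psd_eigenvalue_ge0 j : psd K -> 0 <= lam j.
Proof.
by move=> [_ /(_ (omega j))]; rewrite eigenpair_dotp dotp_omega mulr1.
Qed.

Lemma identity_eigenvalue j : K = 1%:M -> lam j = 1.
Proof.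
move=> K1; have := eigenpair_dotp (omega j) j.
by rewrite K1 mul1mx dotp_omega mulr1.
Qed.

(** By contraposition: if v is orthogonal to every eigenvector of positive eigenvalue, then each
    entry lam_j <v, omega_j> of v^T K W vanishes, where the columns of W are the eigenvectors; hence
    v^T K = 0. *)
Lemma quadratic_form_neq0 (v : 'cV[R]_d) : psd K -> dotp v (K *m v) != 0 ->
  exists j, 0 < lam j /\ dotp v (omega j) != 0.
Proof.
move=> psdK; apply: contra_neqP => nj.
pose W : 'M[R]_d := \matrix_(i, j) omega j i 0.
have colW j : col j W = omega j.
  by apply/matrixP => i k; rewrite !mxE ord1.
have WTW : W^T *m W = 1%:M.
  apply/matrixP => i j; rewrite !mxE -eigen.2 /dotp mxE.
  by apply: eq_bigr => k _; rewrite !mxE.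
have vKW : v^T *m K *m W = 0.
  apply/rowP => j; rewrite [RHS]mxE.
  have -> : (v^T *m K *m W) 0 j = dotp v (K *m omega j).
    rewrite /dotp mulmxA -colW !mxE; apply: eq_bigr => k _.
    by rewrite !mxE.
  rewrite eigenpair_dotp; apply/eqP; rewrite mulf_eq0 orbC.
  apply/orP; case: (eqVneq (dotp v (omega j)) 0) => [|vj]; [by left|right].
  rewrite eq_le psd_eigenvalue_ge0// andbT leNgt; apply/negP => lj.
  by apply: nj; exists j.
(* W is square, so W^T W = 1 gives W W^T = 1, which is inserted after v^T K. *)
rewrite /dotp mulmxA -[v^T *m K]mulmx1 -(mulmx1C WTW) mulmxA vKW.
by rewrite !mul0mx mxE.
Qed.

End Spectral.

(* Gam is the set of learning rates under consideration; qinf gam is the chosen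
   admissible solution q_gam(infinity). *)
Theorem proposition6p3 (R : realType) (d : nat)
  (K : 'M[R]_d) (lam : 'I_d -> R) (omega : 'I_d -> 'cV[R]_d)
  (Xstar X0 : 'cV[R]_d) (delta : R)
  (Gam : set R) (V11 V12 : R -> R -> 'I_d -> R) (qinf : R -> R) :
  let x := fun j => dotp Xstar (omega j) in
  let x0 := fun j => dotp X0 (omega j) in
  let dm := delta_minus lam x in
  let dp := delta_plus lam x in
  psd K ->
  orthonormal_eigenpairs K lam omega ->
  (forall gam, Gam gam -> 0 < gam) ->
  closure Gam 0 ->
  (forall gam, Gam gam ->
    adv_flow gam delta lam x x0 (V11 gam) (V12 gam)) ->
  (forall gam, Gam gam ->
    0 < risk lam x (V11 gam 0) (V12 gam 0) /\ 0 < B44 (V11 gam 0)) ->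
  0 < dotp Xstar (K *m Xstar) ->
  (forall gam, Gam gam ->
    has_ubound [set risk_adv delta lam x (V11 gam t) (V12 gam t)
               | t in [set t : R | 0 <= t]]) ->
  0 < delta ->
  (forall gam, Gam gam ->
    exists2 q : R, 0 < q &
      qratio lam x (V11 gam t) (V12 gam t) @[t --> +oo] --> q) ->
  delta <= Num.sqrt (lam_min_pos K / r_star) ->
  (forall gam, Gam gam -> admissible_solution gam delta lam x (qinf gam)) ->
  [/\ delta <= dm ->
        qinf gam @[gam --> within Gam 0^'+] --> +oo /\
        lam_eff delta (qinf gam) @[gam --> within Gam 0^'+] --> (0 : R),
      dm < delta < dp ->
        exists q_star lam_star : R,
          [/\ 0 < q_star /\ 0 < lam_star,
              qinf gam @[gam --> within Gam 0^'+] --> q_star /\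
              lam_eff delta (qinf gam) @[gam --> within Gam 0^'+] --> lam_star,
              limit_system delta lam x q_star lam_star,
              (forall q l : R, 0 < q -> 0 < l -> limit_system delta lam x q l ->
                 q = q_star /\ l = lam_star) &
              K = 1%:M ->
                q_star = (1 - delta * Num.sqrt (2 / pi))
                         / (delta * (delta - Num.sqrt (2 / pi))) /\
                lam_star = (delta ^+ 2 - delta * Num.sqrt (2 / pi))
                           / (1 - delta * Num.sqrt (2 / pi))],
      dp <= delta ->
        qinf gam @[gam --> within Gam 0^'+] --> (0 : R) /\
        lam_eff delta (qinf gam) @[gam --> within Gam 0^'+] --> +oo &
      K = 1%:M -> dm = Num.sqrt (2 / pi) /\ dp = Num.sqrt (pi / 2)].
Proof.
move=> x x0 dm dp psdK eigen _ _ _ _ XKX _ delta0 _ _ adm.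
have lam0 j : 0 <= lam j := psd_eigenvalue_ge0 eigen j psdK.
(* This index makes every sum over the positive eigenvalues strictly positive. *)
have [j0 [lj0]] := quadratic_form_neq0 eigen psdK (lt0r_neq0 XKX).
rewrite -/(x j0) => xj0.
have delta_isotropic : K = 1%:M -> dm = cpi /\ dp = Num.sqrt (pi / 2).
  move=> K1; have lam1 j : lam j = 1 := identity_eigenvalue eigen j K1.
  have s0 : \sum_(j | 0 < lam j) x j ^+ 2 != 0.
    have : 0 < wsum lam x 2 1 0 by apply: (wsum_gt0 _ lj0 xj0); rewrite ?addr0.
    by rewrite (wsum10E lam x).1 => /lt0r_neq0.
  split; rewrite /dm /dp /delta_minus /delta_plus.
    rewrite (_ : \sum_(j | _) _ / _ = \sum_(j | 0 < lam j) x j ^+ 2).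
      by rewrite divff// sqrtr1 mulr1.
    by apply: eq_bigr => j _; rewrite lam1 divr1.
  have sumE k : \sum_(j | 0 < lam j) lam j ^+ k * x j ^+ 2
      = \sum_(j | 0 < lam j) x j ^+ 2.
    by apply: eq_bigr => j _; rewrite lam1 expr1n mul1r.
  by rewrite sumE (sumE 1%N) divff// sqrtr1 mulr1.
split => //.
- exact: (cvg_le_delta_minus lam0 lj0 xj0 delta0 adm).
- case/andP => dm_lt lt_dp; have [hdm hdp] := (dm_lt, lt_dp).
  rewrite ltNge (le_delta_minus lj0 xj0 delta0) -ltNge in hdm.
  rewrite ltNge (ge_delta_plus lj0 xj0 delta0) -ltNge in hdp.
  have [q q0 Hq] := Hfp_root lj0 xj0 delta0 hdm hdp.
  have [cq cl] := cvg_Hfp1 lam0 lj0 xj0 delta0 adm q0 Hq.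
  exists q, (lam_eff delta q); split => //.
  + by split => //; exact: lam_eff_gt0.
  + by apply/(limit_systemP lam0 lj0 xj0 delta0 _ q0).
  + move=> p l p0 _ /(limit_systemP lam0 lj0 xj0 delta0 _ p0)[Hp ->].
    have -> // : p = q.
    by apply: (Hfp_inj lj0 xj0 delta0 p0 q0); rewrite Hp.
  + move=> K1; have lam1 j : lam j = 1 := identity_eigenvalue eigen j K1.
    have mn := Hfp_isotropic lj0 xj0 delta0 q0 lam1 Hq.
    have [dmE dpE] := delta_isotropic K1.
    rewrite -/cpi; move: dm_lt lt_dp; rewrite dmE dpE sqrt_pihalf => c_lt lt_c.
    (* The bounds c < delta < 1 / c make both factors in the closed forms positive. *)
    have dc1 : 0 < 1 - delta * cpi.
      by rewrite subr_gt0 -ltr_pdivlMr ?cpi_gt0// mul1r.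
    have dc0 : 0 < delta - cpi by rewrite subr_gt0.
    have qE : q = (1 - delta * cpi) / (delta * (delta - cpi)).
      (* [mn] becomes delta^2 q + delta c = 1 + delta c q, which is linear in q. *)
      rewrite /mfp /nfp in mn.
      apply: (canRL (mulfK _)); last by lra.
      by rewrite gt_eqF// mulr_gt0.
    (* Since mfp = nfp, the quotient mfp / (q nfp) is 1 / q. *)
    split => //; have -> : lam_eff delta q = q^-1.
      have n0 := nfp_gt0 delta0 (ltW q0).
      by rewrite lam_effE// mn; field; rewrite !gt_eqF.
    by rewrite qE invf_div; congr (_ / _); ring.
- exact: (cvg_ge_delta_plus lam0 lj0 xj0 delta0 adm).
Qed.
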